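(* Let $k$ be any positive integer, let $a_1>0$ and $b_1>0$ be real numbers, and let $\alpha,\beta$ be real constants with $0<\alpha<\beta<1-\alpha<1$. For $i=1,\ldots,k$ put $a_i=a_1(2-\alpha^{i-1})$ and $b_i=b_1\beta^{i-1}$. Then the function $$f(x,y)=\sum_{i=1}^k x^{a_i}y^{b_i}$$ is irreducible.
   Context: Big-oh in two variables: for real functions $f(n_1,n_2)$ and $g(n_1,n_2)$ of nonnegative arguments, $f(n_1,n_2)=O(g(n_1,n_2))$ means there exist positive constants $c$, $n_{1,0}$, $n_{2,0}$ such that $f(n_1,n_2)\le c\,g(n_1,n_2)$ for all $n_1,n_2\ge 0$ satisfying $n_1\ge n_{1,0}$ or $n_2\ge n_{2,0}$. A term is a product of single-variable functions (here each $x^{a_i}y^{b_i}$). Given terms $T_1,\ldots,T_k$ and $S=T_1+\cdots+T_k$, the term $T_i$ is independent with respect to $S$ if $T_i=O(S-T_i)$ does not hold; $S$ is irreducible if every $T_i$ is independent with respect to $S$. *)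

(* Defs.v *)
From HB Require Import structures.
From mathcomp Require Export all_boot all_order all_algebra.
From mathcomp Require Export reals exp.

Set Implicit Arguments.
Unset Strict Implicit.
Unset Printing Implicit Defensive.

Import Order.TTheory GRing.Theory Num.Theory.
Local Open Scope ring_scope.

(* The bound is required as soon as ONE of the two arguments is large, the
   other one ranging over all nonnegative reals. Functions are total on R, but
   only their values at nonnegative arguments matter. *)
Definition bigO2 (R : realType) (f g : R -> R -> R) : Prop :=
  exists c x0 y0 : R,
    [/\ 0 < c, 0 < x0, 0 < y0 &
      forall x y : R, 0 <= x -> 0 <= y -> x0 <= x \/ y0 <= y ->
        f x y <= c * g x y].

Record term (R : realType) := Term { xfactor : R -> R; yfactor : R -> R }.

Definition term_fun (R : realType) (t : term R) (x y : R) : R :=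
  xfactor t x * yfactor t y.

Definition term_sum (R : realType) (k : nat) (T : 'I_k -> term R) (x y : R) : R :=
  \sum_(i < k) term_fun (T i) x y.

Definition independent (R : realType) (t : term R) (S : R -> R -> R) : Prop :=
  ~ bigO2 (term_fun t) (fun x y => S x y - term_fun t x y).

(* Irreducibility is a property of a sum presented by its family of terms. *)
Definition irreducible_sum (R : realType) (k : nat) (T : 'I_k -> term R) : Prop :=
  forall i : 'I_k, independent (T i) (term_sum T).

(* x^a y^b; powR gives 0 `^ a = 0 for a != 0, as usual for a > 0. *)
Definition power_term (R : realType) (a b : R) : term R :=
  Term (fun x => x `^ a) (fun y => y `^ b).

(* Main.v *)
(** A term x^a y^b whose exponent vector (a, b) is the unique maximiser of some
    linear form p a + q b with p > 0 is independent: along the curve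
    x = e^(ps), y = e^(qs) it eventually exceeds any multiple of the sum of the
    other terms.  For the i-th exponent vector the form with
    p = alpha beta^i / a1 and q = beta alpha^i / b1 works; its maximality over
    later indices comes from alpha (1 - alpha) < beta (1 - beta), and over
    earlier ones from alpha < beta. *)

Require Import Defs.
From mathcomp Require Import all_boot all_order all_algebra.
From mathcomp Require Import reals exp.
From mathcomp Require Import sequences ring lra.
Import Order.TTheory GRing.Theory Num.Theory.
Local Open Scope ring_scope.

Lemma power_term_expR (R : realType) (a b u v : R) :
  term_fun (power_term a b) (expR u) (expR v) = expR (u * a + v * b).
Proof. by rewrite /term_fun /= -!expRM expRD. Qed.

Lemma independent_of_linear_max (R : realType) (k : nat) (a b : 'I_k -> R)
    (i : 'I_k) (p q : R) :
  0 < p ->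
  (forall j, j != i -> p * a j + q * b j < p * a i + q * b i) ->
  independent (power_term (a i) (b i))
              (term_sum (fun j => power_term (a j) (b j))).
Proof.
move=> p0 imax [c [x0 [y0 [c0 x00 _ H]]]].
pose V j := p * a j + q * b j.
pose K : R := k%:R.
have K0 : 0 < K by rewrite ltr0n; exact: leq_ltn_trans (ltn_ord i).
have cK0 : 0 < c * K by rewrite mulr_gt0.
(* All summands are positive, so [s] exceeds each of them: [x0 / p] makes [x] large, the others give
   [c * K <= s * (V i - V j)]. Both pass to exponentials by e^t >= 1 + t. *)
pose s := x0 / p + \sum_(j | j != i) c * K / (V i - V j).
have W0 j : j != i -> 0 < c * K / (V i - V j).
  by move=> ji; rewrite divr_gt0// subr_gt0 imax.
have sx0 : x0 <= s * p.
  rewrite -ler_pdivrMr// lerDl sumr_ge0// => j ji; exact/ltW/W0.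
have sV j : j != i -> c * K <= s * (V i - V j).
  move=> ji; rewrite -ler_pdivrMr ?subr_gt0 ?imax// /s (bigD1 j)//=.
  rewrite addrCA lerDl addr_ge0//; first by rewrite divr_ge0// ltW.
  by rewrite sumr_ge0// => l /andP[li _]; exact/ltW/W0.
have sub j : j != i -> K * (c * expR (s * V j)) <= expR (s * V i).
  move=> ji; rewrite -[s * V i](subrK (s * V j)) expRD mulrA ler_pM2r ?expR_gt0//.
  rewrite mulrC -mulrBr; apply: le_trans (expR_ge1Dx _).
  by have := sV j ji; lra.
have termE j : term_fun (power_term (a j) (b j)) (expR (s * p)) (expR (s * q))
    = expR (s * V j).
  by rewrite power_term_expR /V mulrDr !mulrA.
have := H (expR (s * p)) (expR (s * q)) (expR_ge0 _) (expR_ge0 _) (or_introl _).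
have xlarge : x0 <= expR (s * p).
  by apply: le_trans (expR_ge1Dx _); lra.
move=> /(_ xlarge); rewrite /term_sum (bigD1 i)//= addrAC subrr add0r.
rewrite termE (eq_bigr _ (fun j _ => termE j)) => bound.
(* By [bound] and [sub], k copies of e^(s V i) are at most k - 1 copies: a contradiction. *)
have : K * expR (s * V i) <= \sum_(j | j != i) expR (s * V i).
  apply: (le_trans (y := K * (c * \sum_(j | j != i) expR (s * V j)))).
    by rewrite ler_pM2l.
  by rewrite !mulr_sumr ler_sum.
have -> : K * expR (s * V i) = \sum_(j < k) expR (s * V i).
  by rewrite sumr_const card_ord mulr_natl.
by rewrite (bigD1 i)//= gerDr leNgt expR_gt0.
Qed.

(** Induction on n: the base is (y - x)(1 - x - y) > 0, and each step adds x^(n+1) x(1 - x) on the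
    left and the larger y^(n+1) y(1 - y) on the right. *)
Lemma mulr_onemX_lt (R : realFieldType) (x y : R) (n : nat) :
  0 < x -> x < y -> y < 1 - x ->
  x * (1 - x ^+ n.+1) < y * (1 - y ^+ n.+1).
Proof.
move=> x0 xy yx.
have base : x * (1 - x) < y * (1 - y) by nra.
elim: n => [|n IH]; first by rewrite !expr1.
have le_X : x ^+ n.+1 * (x * (1 - x)) <= y ^+ n.+1 * (y * (1 - y)).
  apply: ler_pM; rewrite ?exprn_ge0 ?(ltW base)//; [lra|nra|].
  by apply: lerXn2r; rewrite ?nnegrE; lra.
rewrite ![_ ^+ n.+2]exprS; nra.
Qed.

(** After division by xy, both factors on the left are dominated by those on the right. *)
Lemma mulr_Xonem_lt (R : realFieldType) (x y : R) (n : nat) :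
  0 < x -> x < y -> y < 1 ->
  y * x ^+ n.+1 * (1 - y ^+ n.+1) < x * y ^+ n.+1 * (1 - x ^+ n.+1).
Proof.
move=> x0 xy y1.
have lt_X : x ^+ n.+1 < y ^+ n.+1 by apply: ltrXn2r; rewrite ?nnegrE; lra.
have le_X : x ^+ n <= y ^+ n by apply: lerXn2r; rewrite ?nnegrE; lra.
have y1n : y ^+ n.+1 < 1 by rewrite exprn_ilt1//; lra.
have -> : y * x ^+ n.+1 * (1 - y ^+ n.+1)
    = x * y * (x ^+ n * (1 - y ^+ n.+1)) by rewrite exprS; ring.
have -> : x * y ^+ n.+1 * (1 - x ^+ n.+1)
    = x * y * (y ^+ n * (1 - x ^+ n.+1)) by rewrite [y ^+ n.+1]exprS; ring.
rewrite ltr_pM2l; last by nra.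
have xn0 : 0 < x ^+ n by rewrite exprn_gt0.
nra.
Qed.

(** Dividing by (xy)^min(i, j) leaves an inequality in the gap between i and j only, one of the two
    above according to the sign of j - i. *)
Lemma geometric_form_max (R : realFieldType) (x y : R) (i j : nat) :
  0 < x -> x < y -> y < 1 - x -> j != i ->
  y * x ^+ i * y ^+ j - x * y ^+ i * x ^+ j
    < y * x ^+ i * y ^+ i - x * y ^+ i * x ^+ i.
Proof.
move=> x0 xy yx; have y0 : 0 < y by lra.
case: ltngtP => // [ji|ij] _.
- rewrite -(subnKC ji) addSnnS !exprD.
  have y1 : y < 1 by lra.
  have := @mulr_Xonem_lt _ x y (i - j.+1) x0 xy y1.
  have : 0 < x ^+ j * y ^+ j by rewrite mulr_gt0 ?exprn_gt0.
  move=> P0; rewrite -(ltr_pM2l P0); lra.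
- rewrite -(subnKC ij) addSnnS !exprD.
  have := @mulr_onemX_lt _ x y (j - i.+1) x0 xy yx.
  have : 0 < x ^+ i * y ^+ i by rewrite mulr_gt0 ?exprn_gt0.
  move=> P0; rewrite -(ltr_pM2l P0); lra.
Qed.

(* Indices i : 'I_k start at 0, so the exponent i-1 of the usual numbering
   from 1 to k is i here. *)
Theorem theorem1 (R : realType) (k : nat) (a1 b1 alpha beta : R)
    (a b : 'I_k -> R)
    (hk : (0 < k)%N)
    (ha1 : 0 < a1) (hb1 : 0 < b1)
    (h0alpha : 0 < alpha) (halphabeta : alpha < beta)
    (hbeta : beta < 1 - alpha) (halpha1 : 1 - alpha < 1)
    (ha : forall i : 'I_k, a i = a1 * (2 - alpha ^+ i))
    (hb : forall i : 'I_k, b i = b1 * beta ^+ i) :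
  irreducible_sum (fun i : 'I_k => power_term (a i) (b i)).
Proof.
move=> i.
have beta0 : 0 < beta by lra.
apply: (@independent_of_linear_max _ _ _ _ _
  (alpha * beta ^+ i / a1) (beta * alpha ^+ i / b1)).
  by rewrite divr_gt0 ?mulr_gt0 ?exprn_gt0.
(* The weights cancel [a1] and [b1]; the constant 2 alpha beta^i is common to both sides. *)
move=> j ji; rewrite !ha !hb !mulrA !divfK ?gt_eqF//.
have := @geometric_form_max _ alpha beta i j h0alpha halphabeta hbeta ji.
lra.
Qed.
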